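(* Let $n\ge 3$ and let $(\mathcal{L},[\cdot,\dots,\cdot],\alpha,\epsilon)$ be a multiplicative $n$-Hom-Lie color algebra. Then $\mathcal{D}(\mathcal{L})$ is a Hom-Lie color subalgebra of the general linear Hom-Lie color algebra $(gl(\mathcal{L}),[\cdot,\cdot],\tilde\alpha,\epsilon)$, where $\tilde\alpha(D)=D\circ\alpha$ for all $D\in\mathcal{D}(\mathcal{L})$; that is, $\tilde\alpha(\mathcal{D}(\mathcal{L}))\subseteq\mathcal{D}(\mathcal{L})$ and $[\mathcal{D}(\mathcal{L}),\mathcal{D}(\mathcal{L})]\subseteq\mathcal{D}(\mathcal{L})$.
   Context: Let $\mathbb{K}$ be a field, $G$ an additive abelian group, and $\epsilon:G\times G\to\mathbb{K}\setminus\{0\}$ a skew-symmetric bicharacter: $\epsilon(g,h)\epsilon(h,g)=1$, $\epsilon(g+h,k)=\epsilon(g,k)\epsilon(h,k)$, $\epsilon(g,h+k)=\epsilon(g,h)\epsilon(g,k)$. For a $G$-graded space $V$, $\mathcal{H}(V)$ is the set of homogeneous elements; inside $\epsilon$, a homogeneous element stands for its degree and a sum of homogeneous elements stands for the sum of their degrees. A linear map $f$ is homogeneous of degree $\theta$ if $f(V_g)\subset V_{g+\theta}$ for all $g\in G$, and even if $\theta=0$. An $n$-Hom-Lie color algebra is a $G$-graded space $\mathcal{L}=\bigoplus_{g\in G}\mathcal{L}_g$ with an $n$-linear bracket $[\cdot,\dots,\cdot]$ compatible with the grading, the bicharacter $\epsilon$, and an even linear map $\alpha:\mathcal{L}\to\mathcal{L}$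 such that for all homogeneous $x_i,y_j$: (i) $[x_1,\dots,x_i,x_{i+1},\dots,x_n]=-\epsilon(x_i,x_{i+1})[x_1,\dots,x_{i+1},x_i,\dots,x_n]$ for $1\le i\le n-1$; (ii) $[\alpha(x_1),\dots,\alpha(x_{n-1}),[y_1,\dots,y_n]]=\sum_{i=1}^n\epsilon(X,Y_i)[\alpha(y_1),\dots,\alpha(y_{i-1}),[x_1,\dots,x_{n-1},y_i],\alpha(y_{i+1}),\dots,\alpha(y_n)]$, with $X=x_1+\dots+x_{n-1}$, $Y_i=y_1+\dots+y_{i-1}$. A Hom-Lie color algebra is the case $n=2$. It is multiplicative if $\alpha([x_1,\dots,x_n])=[\alpha(x_1),\dots,\alpha(x_n)]$. For $k\ge 0$, a double $\alpha^k$-derivation of degree $d$ of $\mathcal{L}$ is a linear map $D:\mathcal{L}\to\mathcal{L}$, homogeneous of degree $d\in G$, with $D\circ\alpha=\alpha\circ D$ and, for all homogeneous $x_i,y_j$, $$D([x_1,\dots,x_{n-1},[y_1,\dots,y_n]])=\sum_{i=1}^{n-1}\epsilon(d,X_i)[\alpha^k(x_1),\dots,D(x_i),\dots,\alpha^k(x_{n-1}),[\alpha^k(y_1),\dots,\alpha^k(y_n)]]$$ $$+\sum_{j=1}^{n}\epsilon(d,X+Y_j)[\alpha^k(x_1),\dots,\alpha^k(x_{n-1}),[\alpha^k(y_1),\dots,D(y_j),\dots,\alpha^k(y_n)]],$$ where $X_i=x_1+\dots+x_{i-1}$, $X=x_1+\dots+x_{n-1}$, $Y_j=y_1+\dots+y_{j-1}$.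 $\mathcal{D}_{\alpha^k}(\mathcal{L})$ is the span of the double $\alpha^k$-derivations, and $\mathcal{D}(\mathcal{L})=\bigoplus_{k\ge0}\mathcal{D}_{\alpha^k}(\mathcal{L})$ denotes the vector space spanned by all of them in $\mathrm{End}(\mathcal{L})$. $gl(\mathcal{L})$ is the $G$-graded space spanned by the homogeneous linear maps $\mathcal{L}\to\mathcal{L}$ commuting with $\alpha$, with color commutator $[D,D']=D\circ D'-\epsilon(d,d')D'\circ D$ for $D,D'$ homogeneous of degrees $d,d'$, and twisting map $\tilde\alpha(D)=D\circ\alpha$. *)

(* Defs.v *)
From HB Require Import structures.
From mathcomp Require Import all_boot all_order all_fingroup all_algebra.
From mathcomp Require Import finmap.
From mathcomp Require Import boolp classical_sets functions cardinality fsbigop.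

Set Implicit Arguments.
Unset Strict Implicit.
Unset Printing Implicit Defensive.

Import GRing.Theory.
Local Open Scope classical_set_scope.
Local Open Scope ring_scope.

Section Subspaces.
Context {K : fieldType} {V : lmodType K}.

Definition subspace (A : set V) := submod_closed (mem A).

Definition span (A : set V) : set V := smallest subspace A.

Lemma subspaceP (A : set V) :
  subspace A <-> A 0 /\ forall a u v, A u -> A v -> A (a *: u + v).
Proof.
split=> -[A0 Alin]; split.
- exact: set_mem.
- move=> a u v /mem_set Au /mem_set Av; apply: set_mem; exact: Alin.
- exact: mem_set.
- move=> a u v /set_mem Au /set_mem Av; apply: mem_set; exact: Alin.
Qed.

Lemma span_subspace (A : set V) : subspace (span A).
Proof.
apply/subspaceP; split; first by move=> B [/subspaceP[]].
move=> a u v Au Av B BA; have [/subspaceP[_ +] _] := BA.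
by apply; [exact: Au|exact: Av].
Qed.

Lemma sub_span (A : set V) : A `<=` span A.
Proof. exact: sub_gen_smallest. Qed.

Lemma span_min (A B : set V) : subspace B -> A `<=` B -> span A `<=` B.
Proof. exact: smallest_sub. Qed.

Lemma subspace0 (A : set V) : subspace A -> A 0.
Proof. by move=> /subspaceP[]. Qed.

Lemma subspaceL (A : set V) a u v : subspace A -> A u -> A v -> A (a *: u + v).
Proof. by move=> /subspaceP[_]; exact. Qed.

Lemma subspaceD (A : set V) u v : subspace A -> A u -> A v -> A (u + v).
Proof. by move=> sA Au Av; rewrite -[u]scale1r; exact: subspaceL. Qed.

Lemma subspaceZ (A : set V) a u : subspace A -> A u -> A (a *: u).
Proof.
by move=> sA Au; rewrite -[_ *: _]addr0; apply: subspaceL => //; exact: subspace0.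
Qed.

Lemma subspaceB (A : set V) u v : subspace A -> A u -> A v -> A (u - v).
Proof.
by move=> sA Au Av; rewrite addrC -scaleN1r; exact: subspaceL.
Qed.

End Subspaces.

Section FiniteSums.
Context {K : fieldType} {G : choiceType} {V : lmodType K}.

Lemma supportP (w : G -> V) : finite_set [set g | w g != 0] ->
  exists A : {fset G}, forall g, g \notin A -> w g = 0.
Proof.
move=> /finite_fsetP[A eA]; exists A => g gA; apply/eqP/negPn/negP => wg.
by have : [set g | w g != 0] g by []; rewrite eA /=; apply/negP.
Qed.

Lemma support_fset (A : {fset G}) (w : G -> V) :
  (forall g, g \notin A -> w g = 0) -> finite_set [set g | w g != 0].
Proof.
move=> wA; apply: (@sub_finite_set _ _ [set` A]); last exact: finite_fset.
by move=> g /= wg; apply/negPn/negP => /wA w0; rewrite w0 eqxx in wg.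
Qed.

Lemma support_lin (a : K) (w w' : G -> V) :
  finite_set [set g | w g != 0] -> finite_set [set g | w' g != 0] ->
  finite_set [set g | a *: w g + w' g != 0].
Proof.
move=> fw fw'; apply: (@sub_finite_set _ _ ([set g | w g != 0] `|` [set g | w' g != 0])).
  move=> g /= h; case: (eqVneq (w g) 0) => wg; [right|by left].
  by move: h; rewrite wg scaler0 add0r.
by rewrite finite_setU.
Qed.

Lemma fsum_lin (a : K) (w w' : G -> V) :
  finite_set [set g | w g != 0] -> finite_set [set g | w' g != 0] ->
  \sum_(g \in [set: G]) (a *: w g + w' g) =
  a *: (\sum_(g \in [set: G]) w g) + \sum_(g \in [set: G]) w' g.
Proof.
move=> /supportP[A wA] /supportP[B wB].
have wU g : g \notin (A `|` B)%fset -> w g = 0 /\ w' g = 0.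
  by rewrite in_fsetU negb_or => /andP[/wA -> /wB ->].
rewrite !(fsbigTE (A `|` B)%fset) ?big_split ?scaler_sumr //.
- by move=> g /wU[].
- by move=> g /wU[].
- by move=> g /wU[-> ->]; rewrite scaler0 addr0.
Qed.

Lemma fsum_single (d : G) (w : G -> V) :
  (forall g, g != d -> w g = 0) -> \sum_(g \in [set: G]) w g = w d.
Proof.
move=> wd; rewrite (fsbigTE [fset d]%fset) ?big_seq_fset1 //.
by move=> g; rewrite in_fset1; exact: wd.
Qed.

End FiniteSums.

Lemma fsum_morph (K : fieldType) (G : choiceType) (V W : lmodType K)
    (f : V -> W) (w : G -> V) : linear f ->
  finite_set [set g | w g != 0] ->
  f (\sum_(g \in [set: G]) w g) = \sum_(g \in [set: G]) f (w g).
Proof.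
move=> lf /supportP[A wA].
pose F : {linear V -> W} := HB.pack f (GRing.isLinear.Build _ _ _ _ f lf).
rewrite -[f]/(F : V -> W) !(fsbigTE A) ?raddf_sum // => g /wA ->.
by rewrite raddf0.
Qed.

Section Gradings.
Context {K : fieldType} {G : zmodType} {V : lmodType K}.

(* Internal direct sum: V is the direct sum of the subspaces V_ g *)
Definition grading (V_ : G -> set V) :=
  (forall g, subspace (V_ g)) /\
  forall v, exists! w : G -> V,
    [/\ forall g, V_ g (w g),
        finite_set [set g | w g != 0] &
        v = \sum_(g \in [set: G]) w g].

Definition component (V_ : G -> set V) (gr : grading V_) (v : V) : G -> V :=
  sval (cid (gr.2 v)).

Context (V_ : G -> set V).

Lemma gradingI : (forall g, subspace (V_ g)) ->
  (forall v, span (\bigcup_g V_ g) v) ->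
  (forall w : G -> V, (forall g, V_ g (w g)) -> finite_set [set g | w g != 0] ->
     \sum_(g \in [set: G]) w g = 0 -> forall g, w g = 0) ->
  grading V_.
Proof.
move=> sV spV indV; split=> // v.
have [w [wV fw vw]] : [set v | exists w : G -> V, [/\ forall g, V_ g (w g),
    finite_set [set g | w g != 0] & v = \sum_(g \in [set: G]) w g]] v.
  apply: span_min (spV v); last first.
    move=> u [d _ uV]; exists (fun g => if g == d then u else 0); split.
    + by move=> g; case: eqP => [->//|_]; exact: subspace0.
    + apply: (@support_fset _ _ _ [fset d]%fset) => g.
      by rewrite in_fset1 => /negbTE ->.
    + by rewrite (@fsum_single _ _ _ d) ?eqxx // => g /negbTE ->.
  apply/subspaceP; split.
    exists (fun=> 0); split=> [g||]; first exact: subspace0.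
    + by apply: (@support_fset _ _ _ fset0).
    + by rewrite (@fsum_single _ _ _ 0).
  move=> a u u' [w [wV fw ->]] [w' [wV' fw' ->]].
  exists (fun g => a *: w g + w' g); split.
  + by move=> g; exact: subspaceL.
  + exact: support_lin.
  + by rewrite fsum_lin.
exists w; split=> // w' [wV' fw' vw']; apply/funext => g.
apply/eqP; rewrite -subr_eq0 addrC -scaleN1r; apply/eqP.
apply: (indV (fun g => -1 *: w' g + w g)).
+ by move=> h; exact: subspaceL.
+ exact: support_lin.
+ by rewrite fsum_lin // -vw -vw' scaleN1r addNr.
Qed.

Context (gr : grading V_).

Lemma componentP v : [/\ forall g, V_ g (component gr v g),
  finite_set [set g | component gr v g != 0] &
  v = \sum_(g \in [set: G]) component gr v g].
Proof. by rewrite /component; case: cid => w []. Qed.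

Lemma component_uniq v w : (forall g, V_ g (w g)) ->
  finite_set [set g | w g != 0] -> v = \sum_(g \in [set: G]) w g ->
  component gr v = w.
Proof. by rewrite /component; case: cid => w' [_ +] wV fw vw /=; apply. Qed.

Lemma component_lin a u v g :
  component gr (a *: u + v) g = a *: component gr u g + component gr v g.
Proof.
have [uV fu {1}->] := componentP u; have [vV fv {1}->] := componentP v.
rewrite -fsum_lin //.
rewrite (@component_uniq _ (fun g => a *: component gr u g + component gr v g)) //.
- by move=> h; apply: subspaceL => //; exact: gr.1.
- exact: support_lin.
Qed.

Lemma component_homog d v g : V_ d v ->
  component gr v g = if g == d then v else 0.
Proof.
move=> vV; rewrite (@component_uniq _ (fun g => if g == d then v else 0)) //.
- by move=> h; case: eqP => [->//|_]; apply: subspace0; exact: gr.1.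
- apply: (@support_fset _ _ _ [fset d]%fset) => h.
  by rewrite in_fset1 => /negbTE ->.
- by rewrite (@fsum_single _ _ _ d) ?eqxx // => h /negbTE ->.
Qed.

Lemma grading_indep (w : G -> V) : (forall g, V_ g (w g)) ->
  finite_set [set g | w g != 0] -> \sum_(g \in [set: G]) w g = 0 ->
  forall g, w g = 0.
Proof.
move=> wV fw w0 g; rewrite -(component_uniq wV fw (esym w0)).
rewrite (@component_homog 0) ?if_same //; apply: subspace0; exact: gr.1.
Qed.

Lemma grading_span v : span (\bigcup_g V_ g) v.
Proof.
have [vV /supportP[A vA] ->] := componentP v.
rewrite (fsbigTE A) //; apply: big_ind.
- by apply: subspace0; exact: span_subspace.
- by move=> x y; apply: subspaceD; exact: span_subspace.
- by move=> g _; apply: sub_span; exists g.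
Qed.

Lemma linear_homog_ext (W : lmodType K) (f f' : V -> W) :
  linear f -> linear f' -> (forall g v, V_ g v -> f v = f' v) -> f = f'.
Proof.
move=> lf lf' ff'; apply/funext => v.
apply: (@span_min _ _ _ [set v | f v = f' v] _ _ v (grading_span v)).
  apply/subspaceP; split.
    by apply: (ff' 0); apply: subspace0; exact: gr.1.
  by move=> a x y /= fx fy; rewrite lf lf' fx fy.
by move=> x [g _]; exact: ff'.
Qed.

Lemma componentwise_linear (W : lmodType K) (F : G -> V -> W) :
  (forall g, linear (F g)) ->
  linear (fun v => \sum_(g \in [set: G]) F g (component gr v g)).
Proof.
move=> lF a u v.
have F0 g : F g 0 = 0.
  by have := lF g (-1) 0 0; rewrite scaler0 addr0 scaleN1r addNr.
rewrite -fsum_lin.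
- by apply: eq_fsbigr => g _; rewrite component_lin lF.
- have [_ + _] := componentP u; apply: sub_finite_set => g /=.
  by apply: contra_neq => ->; exact: F0.
- have [_ + _] := componentP v; apply: sub_finite_set => g /=.
  by apply: contra_neq => ->; exact: F0.
Qed.

End Gradings.

Record skewBicharacter (K : fieldType) (G : zmodType) := SkewBicharacter {
  bichar :> G -> G -> K;
  bichar_neq0 : forall g h, bichar g h != 0;
  bichar_skew : forall g h, bichar g h * bichar h g = 1;
  bicharDl : forall g h k, bichar (g + h) k = bichar g k * bichar h k;
  bicharDr : forall g h k, bichar g (h + k) = bichar g h * bichar g k
}.

Definition homogeneous_map (K : fieldType) (G : zmodType) (V : lmodType K)
    (V_ : G -> set V) (d : G) (f : V -> V) :=
  forall g v, V_ g v -> V_ (g + d) (f v).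

(* (x_1, ..., x_(n-1), z), meaningful for n >= 1 *)
Definition with_last (T : Type) (n : nat) (x : 'I_n.-1 -> T) (z : T) : 'I_n -> T :=
  fun i => oapp x z (insub (val i)).

(* Axioms about homogeneous elements quantify over the elements together with  *)
(* their degrees, as the zero vector is homogeneous of every degree.           *)
Record homLieColor (K : fieldType) (G : zmodType) (eps : skewBicharacter K G)
    (n : nat) := HomLieColor {
  carrier :> lmodType K;
  homog : G -> set carrier;
  br : ('I_n -> carrier) -> carrier;
  twist : {linear carrier -> carrier};
  homog_grading : grading homog;
  br_linear : forall (i : 'I_n) (x : 'I_n -> carrier),
    linear (fun u : carrier => br [eta x with i |-> u]);
  br_graded : forall (d : 'I_n -> G) (x : 'I_n -> carrier),
    (forall i, homog (d i) (x i)) -> homog (\sum_i d i) (br x);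
  twist_even : homogeneous_map homog 0 twist;
  br_skew : forall (d : 'I_n -> G) (x : 'I_n -> carrier),
    (forall i, homog (d i) (x i)) ->
    forall i j : 'I_n, j = i.+1 :> nat ->
      br x = - (eps (d i) (d j) *: br (x \o tperm i j));
  br_jacobi : forall (d : 'I_n.-1 -> G) (e : 'I_n -> G)
      (x : 'I_n.-1 -> carrier) (y : 'I_n -> carrier),
    (forall i, homog (d i) (x i)) -> (forall j, homog (e j) (y j)) ->
    br (with_last (twist \o x) (br y)) =
    \sum_(i < n) eps (\sum_j d j) (\sum_(j < n | (j < i)%N) e j) *:
      br [eta twist \o y with i |-> br (with_last x (y i))]
}.

Arguments homog {K G eps n} A g : rename.
Arguments br {K G eps n A} x : rename.
Arguments twist {K G eps n} A : rename.
Arguments homog_grading {K G eps n} A : rename.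

Section HomLieColorTheory.
Context {K : fieldType} {G : zmodType} {eps : skewBicharacter K G} {n : nat}.

Definition multiplicative_hlc (L : homLieColor eps n) :=
  forall x : 'I_n -> L, twist L (br x) = br (twist L \o x).

Definition graded_subspace (A : homLieColor eps n) (U : set A) :=
  subspace U /\ U `<=` span (\bigcup_g (U `&` homog A g)).

Definition color_subalgebra (A : homLieColor eps n) (U : set A) :=
  [/\ graded_subspace U,
      forall x, U x -> U (twist A x) &
      forall x : 'I_n -> A, (forall i, U (x i)) -> U (br x)].

End HomLieColorTheory.

Section GeneralLinear.
Context {K : fieldType} {G : zmodType} {eps : skewBicharacter K G} {n : nat}.
Context (L : homLieColor eps n).

(* L -> L carries the pointwise K-vector space structure. *)
Definition gl_homog (d : G) : set (L -> L) :=
  [set f | [/\ linear f, homogeneous_map (homog L) d f & f \o twist L = twist L \o f]].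

Definition gl_space : set (L -> L) := span (\bigcup_d gl_homog d).

Record gl_type := GlType { gl_fun :> L -> L; gl_funP : gl_fun \in gl_space }.

HB.instance Definition _ := [isSub for gl_fun].
HB.instance Definition _ := [Choice of gl_type by <:].

Lemma gl_space_subspace : submod_closed (mem gl_space).
Proof. exact: span_subspace. Qed.

HB.instance Definition _ :=
  GRing.SubChoice_isSubLmodule.Build K (L -> L) _ gl_type gl_space_subspace.

Lemma fct_zeroE x : (0 : L -> L) x = 0.
Proof. by []. Qed.

Lemma fct_linE a (f g : L -> L) x : (a *: f + g) x = a *: f x + g x.
Proof. by []. Qed.

Lemma gl_ind (P : set (L -> L)) : subspace P ->
  (forall d, gl_homog d `<=` P) -> forall f : gl_type, P f.
Proof.
move=> sP hP f; apply: span_min sP _ _ (set_mem (gl_funP f)).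
by move=> h [d _]; exact: hP.
Qed.

Lemma gl_linear (f : gl_type) : linear f.
Proof.
apply: (@gl_ind [set f : L -> L | linear f]) => [|d h []//].
apply/subspaceP; split=> [a u v|a f1 f2 /= l1 l2 b u v] /=.
  by rewrite !fct_zeroE scaler0 addr0.
rewrite !fct_linE l1 l2 !scalerDr !scalerA addrACA; congr (_ + _ + (_ + _)).
by rewrite mulrC.
Qed.

Lemma gl_commutes (f : gl_type) x : f (twist L x) = twist L (f x).
Proof.
apply: (@gl_ind [set f : L -> L | forall x, f (twist L x) = twist L (f x)]).
- apply/subspaceP; split=> [y|a f1 f2 /= c1 c2 y] /=.
    by rewrite !fct_zeroE raddf0.
  by rewrite !fct_linE c1 c2 linearP.
- by move=> d h [_ _ +] y => /(congr1 (fun k => k y)).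
Qed.

Lemma gl_homog_comp d e f g : gl_homog d f -> gl_homog e g ->
  gl_homog (d + e) (f \o g).
Proof.
move=> [lf hf cf] [lg hg cg]; split.
- by move=> a u v /=; rewrite lg lf.
- by move=> k v Lv; rewrite [d + e]addrC addrA; apply: hf; exact: hg.
- by rewrite -compA cg compA cf.
Qed.

Lemma gl_comp_subproof (f g : gl_type) : f \o g \in gl_space.
Proof.
apply: mem_set; have sG : subspace gl_space := gl_space_subspace.
have lf := gl_linear f.
apply: (@gl_ind [set g : L -> L | gl_space (f \o g)]).
  apply/subspaceP; split=> [|a g1 g2 /= c1 c2] /=.
    suff -> : f \o (0 : L -> L) = 0 by exact: subspace0.
    apply/funext => x /=; rewrite !fct_zeroE.
    by have := lf (-1) 0 0; rewrite scaler0 addr0 scaleN1r addNr.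
  suff -> : f \o (a *: g1 + g2) = a *: (f \o g1) + (f \o g2) by exact: (subspaceL a sG c1 c2).
  by apply/funext => x /=; rewrite !fct_linE lf.
move=> e h hh /=.
apply: (@gl_ind [set f : L -> L | gl_space (f \o h)]).
  apply/subspaceP; split=> [|a g1 g2 /= c1 c2] /=.
    suff -> : (0 : L -> L) \o h = 0 by exact: subspace0.
    by apply/funext.
  suff -> : (a *: g1 + g2) \o h = a *: (g1 \o h) + (g2 \o h) by exact: (subspaceL a sG c1 c2).
  by apply/funext.
by move=> d k hk /=; apply: sub_span; exists (d + e) => //; exact: gl_homog_comp.
Qed.

Definition gl_comp (f g : gl_type) : gl_type := GlType (gl_comp_subproof f g).

Lemma gl_twist_homog : gl_homog 0 (twist L).
Proof. by split=> //; [exact: linearP|exact: twist_even]. Qed.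

Lemma gl_alpha_subproof : (twist L : L -> L) \in gl_space.
Proof. by apply: mem_set; apply: sub_span; exists 0 => //; exact: gl_twist_homog. Qed.

Lemma gl_twist_subproof (f : gl_type) : f \o twist L \in gl_space.
Proof. exact: (gl_comp_subproof f (GlType gl_alpha_subproof)). Qed.

Definition gl_twist (f : gl_type) : gl_type := GlType (gl_twist_subproof f).

Lemma gl_ext (f g : gl_type) : (forall x, f x = g x) -> f = g.
Proof. by move=> fg; apply: val_inj; apply/funext. Qed.

Lemma gl_linE a (f g : gl_type) x : (a *: f + g) x = a *: f x + g x.
Proof. by []. Qed.

Lemma gl_addE (f g : gl_type) x : (f + g) x = f x + g x.
Proof. by []. Qed.

Lemma gl_oppE (f : gl_type) x : (- f) x = - f x.
Proof. by []. Qed.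

Lemma gl_scaleE a (f : gl_type) x : (a *: f) x = a *: f x.
Proof. by []. Qed.

Lemma gl_compE (f g : gl_type) x : gl_comp f g x = f (g x).
Proof. by []. Qed.

Lemma gl_twistE (f : gl_type) x : gl_twist f x = f (twist L x).
Proof. by []. Qed.

Definition glE := (gl_compE, gl_twistE, gl_addE, gl_oppE, gl_scaleE).

Lemma gl_twist_linear : linear gl_twist.
Proof. by move=> a f g; apply: gl_ext. Qed.

HB.instance Definition _ :=
  GRing.isLinear.Build K gl_type gl_type _ gl_twist gl_twist_linear.

Definition gl_deg (d : G) : set gl_type := [set f | gl_homog d f].

Lemma gl_deg_subspace d : subspace (gl_deg d).
Proof.
apply/subspaceP; split.
  split; [by have := gl_linear 0| |by have := gl_commutes 0 => c; apply/funext].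
  by move=> g v _; apply: subspace0; exact: (homog_grading L).1.
move=> a f g [lf hf cf] [lg hg cg]; split.
- exact: gl_linear.
- move=> k v kv; rewrite gl_linE; apply: subspaceL; first exact: (homog_grading L).1.
    exact: hf.
  exact: hg.
- by apply/funext => x; exact: gl_commutes.
Qed.

Lemma gl_grading : grading gl_deg.
Proof.
apply: gradingI; first exact: gl_deg_subspace.
  move=> f; pose P := [set h : L -> L | exists2 k : gl_type,
     span (\bigcup_d gl_deg d) k & h = k].
  have sS := @span_subspace _ _ (\bigcup_d gl_deg d).
  have [] : P f; last by move=> k sk /val_inj ->.
  apply: (gl_ind (P := P)).
    apply/subspaceP; split; first by exists 0 => //; exact: (subspace0 sS).
    move=> a h1 h2 [k1 s1 ->] [k2 s2 ->]; exists (a *: k1 + k2) => //.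
    exact: (subspaceL a sS s1 s2).
  move=> d h hh.
  have hg : h \in gl_space by apply: mem_set; apply: sub_span; exists d.
  by exists (GlType hg) => //; apply: sub_span; exists d.
move=> w wV fw w0 g; apply: val_inj; apply: (linear_homog_ext (homog_grading L)).
- exact: gl_linear.
- exact: gl_linear 0.
move=> h v hv.
have evl : linear (fun f : gl_type => f v) by [].
pose w' k := w (k - h) v.
have e : w' (g + h) = 0; last by rewrite /w' addrK in e.
apply: (grading_indep (homog_grading L) (w := w')).
- by move=> k; have [_ + _] := wV (k - h) => /(_ h v hv); rewrite addrC subrK.
- move/supportP: fw => [A wA].
  apply: (support_fset (A := [fset (k + h)%R | k in A]%fset)) => k kA.
  rewrite /w' wA //; apply: contra kA => kA; apply/imfsetP; exists (k - h) => //.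
  by rewrite subrK.
- have := fsum_morph evl fw; rewrite w0.
  rewrite [X in _ = X](reindex_fsbigT (fun k : G => k - h)) => [<- //|].
  by exists (fun k => k + h) => k; rewrite ?subrK ?addrK.
Qed.

Definition gl_homog_comm (d e : G) (f g : gl_type) : gl_type :=
  gl_comp f g - eps d e *: gl_comp g f.

(* The color commutator extended bilinearly from homogeneous maps *)
Definition gl_comm (f g : gl_type) : gl_type :=
  \sum_(d \in [set: G]) \sum_(e \in [set: G])
    gl_homog_comm d e (component gl_grading f d) (component gl_grading g e).

Lemma gl_homog_comm_linearl d e g : linear (gl_homog_comm d e ^~ g).
Proof.
move=> a f1 f2; apply: gl_ext => x; rewrite /gl_homog_comm.
rewrite !glE gl_linear.
by rewrite !scalerDr !opprD !scalerN !scalerA [a * _]mulrC addrACA.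
Qed.

Lemma gl_homog_comm_linearr d e f : linear (gl_homog_comm d e f).
Proof.
move=> a g1 g2; apply: gl_ext => x; rewrite /gl_homog_comm.
rewrite !glE gl_linear.
by rewrite !scalerDr !opprD !scalerN !scalerA [a * _]mulrC addrACA.
Qed.

Lemma linear0_fun (V W : lmodType K) (f : V -> W) : linear f -> f 0 = 0.
Proof. by move=> lf; have := lf (-1) 0 0; rewrite scaler0 addr0 scaleN1r addNr. Qed.

Lemma gl_comm_linearr f : linear (gl_comm f).
Proof.
move=> a g1 g2; rewrite /gl_comm.
have lF d := componentwise_linear gl_grading
  (fun e => gl_homog_comm_linearr d e (component gl_grading f d)).
rewrite -fsum_lin.
- by apply: eq_fsbigr => d _; rewrite lF.
all: have [_ + _] := componentP gl_grading f; apply: sub_finite_set => d /=.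
all: apply: contra_neq => ->; rewrite (@fsum_single _ _ _ 0).
all: try by rewrite (linear0_fun (gl_homog_comm_linearl _ _ _)).
all: by move=> e _; rewrite (linear0_fun (gl_homog_comm_linearl _ _ _)).
Qed.

Lemma gl_comm_linearl g : linear (gl_comm ^~ g).
Proof.
apply: (componentwise_linear gl_grading (F := fun d f =>
  \sum_(e \in [set: G]) gl_homog_comm d e f (component gl_grading g e))) => d a f1 f2.
rewrite -fsum_lin.
- by apply: eq_fsbigr => e _; rewrite gl_homog_comm_linearl.
all: have [_ + _] := componentP gl_grading g; apply: sub_finite_set => e /=.
all: by apply: contra_neq => ->; rewrite (linear0_fun (gl_homog_comm_linearr _ _ _)).
Qed.

Lemma gl_commE d e f g : gl_deg d f -> gl_deg e g ->
  gl_comm f g = gl_homog_comm d e f g.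
Proof.
move=> df eg; rewrite /gl_comm (@fsum_single _ _ _ d) => [|k kd].
  rewrite (@fsum_single _ _ _ e) => [|l le].
    by rewrite (component_homog _ _ df) (component_homog _ _ eg) !eqxx.
  rewrite (component_homog _ l eg) (negbTE le).
  exact: (linear0_fun (gl_homog_comm_linearr _ _ _)).
rewrite (component_homog _ k df) (negbTE kd) (@fsum_single _ _ _ 0) => [|l _];
exact: (linear0_fun (gl_homog_comm_linearl _ _ _)).
Qed.

Lemma gl_deg_comm d e f g : gl_deg d f -> gl_deg e g -> gl_deg (d + e) (gl_comm f g).
Proof.
move=> df eg; rewrite (gl_commE df eg) /gl_homog_comm.
have sD := gl_deg_subspace (d + e).
apply: (subspaceB sD); first exact: gl_homog_comp.
by apply: (subspaceZ _ sD); rewrite addrC; exact: gl_homog_comp.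
Qed.

Lemma gl_comm_skew d e f g : gl_deg d f -> gl_deg e g ->
  gl_comm f g = - (eps d e *: gl_comm g f).
Proof.
move=> df eg; rewrite (gl_commE df eg) (gl_commE eg df) /gl_homog_comm.
by rewrite scalerBr scalerA bichar_skew scale1r opprB.
Qed.

Lemma gl_deg_twist d f : gl_deg d f -> gl_deg d (gl_twist f).
Proof. by move=> df; rewrite -[d]addr0; apply: gl_homog_comp gl_twist_homog. Qed.

Lemma gl_comm_jacobi d e1 e2 f g1 g2 : gl_deg d f -> gl_deg e1 g1 -> gl_deg e2 g2 ->
  gl_comm (gl_twist f) (gl_comm g1 g2) =
  gl_comm (gl_comm f g1) (gl_twist g2) +
  eps d e1 *: gl_comm (gl_twist g1) (gl_comm f g2).
Proof.
move=> df dg1 dg2.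
have tf := gl_deg_twist df; have tg1 := gl_deg_twist dg1; have tg2 := gl_deg_twist dg2.
rewrite (gl_commE tf (gl_deg_comm dg1 dg2)) (gl_commE (gl_deg_comm df dg1) tg2).
rewrite (gl_commE tg1 (gl_deg_comm df dg2)).
rewrite (gl_commE dg1 dg2) (gl_commE df dg1) (gl_commE df dg2).
have tB u v : twist L (u - v) = twist L u - twist L v by exact: raddfB.
have tZ a u : twist L (a *: u) = a *: twist L u by exact: linearZ.
have lB (u : gl_type) x y : u (x - y) = u x - u y.
  by rewrite -[- y]scaleN1r addrC gl_linear scaleN1r addrC.
have lZ (u : gl_type) a x : u (a *: x) = a *: u x.
  by rewrite -[a *: x]addr0 gl_linear (linear0_fun (gl_linear u)) addr0.
apply: gl_ext => x; rewrite /gl_homog_comm.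
rewrite !glE !gl_commutes.
rewrite !(lB, lZ, scalerBr, opprB, scalerA, bicharDr, bicharDl).
rewrite !(tB, tZ, scalerBr, scalerA).
rewrite ![eps d e1 * (eps e1 d * _)]mulrA bichar_skew mul1r.
rewrite [eps e1 e2 * _]mulrC [eps d e2 * _ * eps d e1]mulrC !mulrA.
rewrite opprB [RHS]addrACA !addrA !subrK -!addrA; congr (_ + _).
by rewrite addrCA [RHS]addrCA; congr (_ + _); exact: addrC.
Qed.

Definition gl_br (x : 'I_2 -> gl_type) : gl_type := gl_comm (x ord0) (x ord_max).

Lemma gl_br_linear (i : 'I_2) (x : 'I_2 -> gl_type) :
  linear (fun u : gl_type => gl_br [eta x with i |-> u]).
Proof.
move=> a u v; rewrite /gl_br /=.
case: (unliftP ord0 i) => [j ->|->] /=.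
  by rewrite [j]ord1 /=; exact: gl_comm_linearr.
exact: gl_comm_linearl.
Qed.

Lemma gl_br_graded (d : 'I_2 -> G) (x : 'I_2 -> gl_type) :
  (forall i, gl_deg (d i) (x i)) -> gl_deg (\sum_i d i) (gl_br x).
Proof.
by move=> dx; rewrite big_ord_recr big_ord1 /=; apply: gl_deg_comm => //;
  rewrite (_ : widen_ord _ _ = ord0) //; exact: val_inj.
Qed.

Lemma gl_twist_even : homogeneous_map gl_deg 0 gl_twist.
Proof. by move=> g f df; rewrite addr0; exact: gl_deg_twist. Qed.

Lemma gl_br_skew (d : 'I_2 -> G) (x : 'I_2 -> gl_type) :
  (forall i, gl_deg (d i) (x i)) -> forall i j : 'I_2, j = i.+1 :> nat ->
  gl_br x = - (eps (d i) (d j) *: gl_br (x \o tperm i j)).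
Proof.
move=> dx i j ij.
have i0 : i = ord0.
  by apply: val_inj => /=; case: i j ij => [[|k] hk] [l hl] //= e; subst l.
have j1 : j = ord_max by apply: val_inj; rewrite /= ij i0.
by rewrite i0 j1 /gl_br /= tpermL tpermR; exact: gl_comm_skew.
Qed.

Lemma gl_br_jacobi (d : 'I_2.-1 -> G) (e : 'I_2 -> G)
    (x : 'I_2.-1 -> gl_type) (y : 'I_2 -> gl_type) :
  (forall i, gl_deg (d i) (x i)) -> (forall j, gl_deg (e j) (y j)) ->
  gl_br (with_last (gl_twist \o x) (gl_br y)) =
  \sum_(i < 2) eps (\sum_j d j) (\sum_(j < 2 | (j < i)%N) e j) *:
    gl_br [eta gl_twist \o y with i |-> gl_br (with_last x (y i))].
Proof.
move=> dx ey; rewrite big_ord_recr big_ord1 /=.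
have wl0 z u : with_last (n := 2) z u ord0 = z ord0 :> gl_type.
  by rewrite /with_last insubT //=; congr z; exact: val_inj.
have wl1 z u : with_last (n := 2) z u ord_max = u :> gl_type.
  by rewrite /with_last insubF.
have -> : widen_ord (leqnSn 1) ord0 = ord0 by exact: val_inj.
rewrite /gl_br /= !wl0 !wl1 /=.
have e0 g : eps g 0 = 1.
  have := bicharDr eps g 0 0; rewrite addr0 => h.
  by apply: (mulfI (bichar_neq0 eps g 0)); rewrite -h mulr1.
rewrite !big_ord1 big_pred0 // e0 scale1r (big_pred1 ord0) => [|j].
  exact: gl_comm_jacobi.
by rewrite ltnS leqn0.
Qed.

(* The general linear Hom-Lie color algebra of L *)
Definition gl : homLieColor eps 2 :=
  HomLieColor gl_grading gl_br_linear gl_br_graded gl_twist_even gl_br_skew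
    gl_br_jacobi.

Definition double_derivation (k : nat) (d : G) : set (L -> L) :=
  [set D | [/\ linear D, homogeneous_map (homog L) d D,
      D \o twist L = twist L \o D &
      forall (dx : 'I_n.-1 -> G) (dy : 'I_n -> G)
             (x : 'I_n.-1 -> L) (y : 'I_n -> L),
        (forall i, homog L (dx i) (x i)) -> (forall j, homog L (dy j) (y j)) ->
        D (br (with_last x (br y))) =
        \sum_(i < n.-1) eps d (\sum_(l < n.-1 | (l < i)%N) dx l) *:
          br (with_last [eta iter k (twist L) \o x with i |-> D (x i)]
                        (br (iter k (twist L) \o y)))
        + \sum_(j < n) eps d (\sum_l dx l + \sum_(l < n | (l < j)%N) dy l) *:
          br (with_last (iter k (twist L) \o x)
                        (br [eta iter k (twist L) \o y with j |-> D (y j)]))]].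

Definition double_der_pow (k : nat) : set (L -> L) :=
  span (\bigcup_d double_derivation k d).

(* A sum of subspaces of End(L), not assumed to be direct *)
Definition double_der : set (L -> L) := span (\bigcup_k double_der_pow k).

End GeneralLinear.

Arguments gl_fun {K G eps n L} g.
Arguments gl_homog {K G eps n} L d f.
Arguments gl_space {K G eps n} L f.
Arguments gl_deg {K G eps n} L d f.
Arguments double_derivation {K G eps n} L k d D.
Arguments double_der_pow {K G eps n} L k D.
Arguments double_der {K G eps n} L D.

(* Main.v *)
(** A double derivation is a twisted color derivation of the single
    (2n-1)-ary operation [x_1, ..., x_(n-1), [y_1, ..., y_n]].  For such an
    operation, in D o D' - eps(d, d') D' o D the terms where D and D' hit two
    distinct slots cancel, as moving D past D' costs exactly eps(d, d').  The
    terms where both hit the same slot add up to the color commutator. *)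
Require Import Defs.
From mathcomp Require Import all_boot all_order all_algebra.
From mathcomp Require Import boolp classical_sets functions.

Import GRing.Theory.
Local Open Scope classical_set_scope.
Local Open Scope ring_scope.

Set Implicit Arguments.
Unset Strict Implicit.
Unset Printing Implicit Defensive.

(** * Auxiliary facts on bicharacters, linear maps and iterates of the twist *)

Section Bicharacter.
Context {K : fieldType} {G : zmodType} (eps : skewBicharacter K G).

Lemma bichar0r g : eps g 0 = 1.
Proof.
by apply: (mulfI (bichar_neq0 eps g 0)); rewrite -bicharDr addr0 mulr1.
Qed.

End Bicharacter.

Lemma linear_funZ (K : fieldType) (V W : lmodType K) (f : V -> W) a u :
  linear f -> f (a *: u) = a *: f u.
Proof. by move=> lf; have := lf a u 0; rewrite !addr0 (linear0_fun lf) addr0. Qed.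

Lemma linear_fun_sum (K : fieldType) (V W : lmodType K) (f : V -> W)
    (I : finType) (F : I -> V) : linear f -> f (\sum_i F i) = \sum_i f (F i).
Proof.
move=> lf; apply: (big_morph f _ (linear0_fun lf)) => u v.
by rewrite -[u]scale1r lf !scale1r.
Qed.

Lemma subspace_preimage (K : fieldType) (V W : lmodType K) (f : V -> W)
    (U : set W) : linear f -> subspace U -> subspace (f @^-1` U).
Proof.
move=> lf sU; apply/subspaceP; split=> [|a u v uU vU] /=.
  by rewrite (linear0_fun lf); exact: subspace0.
by rewrite lf; exact: subspaceL.
Qed.

Section TwistIterates.
Context {K : fieldType} {G : zmodType} {eps : skewBicharacter K G} {n : nat}.
Context (L : homLieColor eps n).

Lemma iter_twist_homog k g (v : L) : homog L g v -> homog L g (iter k (twist L) v).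
Proof.
by move=> gv; elim: k => //= k IH; rewrite -[g]addr0; apply: twist_even.
Qed.

Lemma iter_twist_comm k (D : L -> L) : D \o twist L = twist L \o D ->
  forall v, D (iter k (twist L) v) = iter k (twist L) (D v).
Proof.
move=> cD v; elim: k => //= k <-.
exact: (congr1 (fun h : L -> L => h _) cD).
Qed.

End TwistIterates.

(** * Twisted color derivations of an operation [T] with arbitrarily indexed slots *)

Section SlotDerivations.
Context {K : fieldType} {G : zmodType} {eps : skewBicharacter K G} {n : nat}.
Context (L : homLieColor eps n) (I : finType) (lt : rel I).
Context (T : (I -> L) -> L).

Definition prefix_degree (dz : I -> G) (s : I) : G := \sum_(t | lt t s) dz t.

(** Only the Leibniz rule is recorded; linearity, degree and commutation with the twist are kept as
    separate conditions. *)
Definition slot_derivation (k : nat) (d : G) (D : L -> L) :=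
  forall (dz : I -> G) (z : I -> L), (forall s, homog L (dz s) (z s)) ->
  D (T z) = \sum_s eps d (prefix_degree dz s) *:
              T [eta iter k (twist L) \o z with s |-> D (z s)].

(** Source of the factor [eps d e]: once a map of degree [e] has acted on slot [s], a second map
    must pass the extra [e] exactly when it acts at a slot after [s]. *)
Lemma prefix_degree_shift dz (s t : I) e :
  prefix_degree [eta dz with s |-> dz s + e] t =
  prefix_degree dz t + (if lt s t then e else 0).
Proof.
rewrite /prefix_degree (eq_bigr (fun r => dz r + (if r == s then e else 0))).
  rewrite big_split; congr (_ + _) => /=; rewrite -big_mkcondr.
  case: ifPn => st.
    by rewrite (big_pred1 s) // => r /=; case: eqVneq => [->|]; rewrite ?st ?andbF.
  by rewrite big_pred0 // => r; case: eqVneq => [->|]; rewrite ?(negbTE st) ?andbF.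
by move=> r _ /=; case: eqP => [->|] //; rewrite addr0.
Qed.

(** The twist moves inside [T] before [D] acts. Being even it changes no degree, and the slots that
    [D] does not hit absorb it into their iterate. *)
Lemma slot_derivation_twist k d D :
  (forall z, twist L (T z) = T (twist L \o z)) ->
  slot_derivation k d D -> slot_derivation k.+1 d (D \o twist L).
Proof.
move=> mT hD dz z hz /=; rewrite mT (hD dz) => [|s]; last first.
  exact: (iter_twist_homog 1).
apply: eq_bigr => s _; congr (_ *: T _); apply/funext => r /=.
by case: ifP => //; rewrite -iterSr.
Qed.

(** Arguments left when [D'] hits [s] and [D] hits [t]: each hit slot carries the twists of the
    other map. For distinct slots the tuple is symmetric under exchanging [k], [D'], [s] with [l],
    [D], [t], which is what lets the mixed terms cancel. *)
Definition two_slots k l (D D' : L -> L) (z : I -> L) (s t : I) : I -> L :=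
  fun r => if r == s then iter k (twist L) (D' (z r))
           else if r == t then iter l (twist L) (D (z r))
           else iter (k + l) (twist L) (z r).

Lemma slot_derivation_comp k l d e D D' :
  linear D -> D \o twist L = twist L \o D -> homogeneous_map (homog L) e D' ->
  slot_derivation k d D -> slot_derivation l e D' ->
  forall (dz : I -> G) (z : I -> L), (forall s, homog L (dz s) (z s)) ->
  D (D' (T z)) =
  \sum_s \sum_t (eps e (prefix_degree dz s) * eps d (prefix_degree dz t) *
                 (if lt s t then eps d e else 1)) *:
    (if t == s then T [eta iter (k + l) (twist L) \o z with s |-> D (D' (z s))]
     else T (two_slots k l D D' z s t)).
Proof.
move=> lD cD hD' dD dD' dz z hz; rewrite (dD' dz) // linear_fun_sum //.
apply: eq_bigr => s _; rewrite linear_funZ //.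
(* [D'] has raised the degree at [s] by [e]; the other arguments were only twisted and keep their
   degrees. *)
rewrite (dD [eta dz with s |-> dz s + e]) => [|r /=]; last first.
  by case: eqP => _; [exact: hD'|exact: iter_twist_homog].
rewrite scaler_sumr; apply: eq_bigr => t _; rewrite scalerA -mulrA.
rewrite prefix_degree_shift bicharDr; congr (_ * (_ * _) *: _).
  by case: ifP => // _; exact: bichar0r.
case: (eqVneq t s) => [->|ts]; congr T; apply/funext => r /=.
  by rewrite eqxx; case: (r == s) => //=; rewrite iterD.
rewrite /two_slots (negbTE ts).
(* At slot [t] the map [D] meets a vector already twisted [l] times; commuting with the twist pulls
   these twists out. *)
rewrite (fun_if (iter k (twist L))) -iterD (iter_twist_comm _ cD).
case: (eqVneq r t) => [->|rt]; first by rewrite (negbTE ts).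
by case: eqP => [->|].
Qed.

Lemma slot_derivation_comm k l d e D D' :
  (forall s z, linear (fun u => T [eta z with s |-> u])) ->
  (forall s, ~~ lt s s) -> (forall s t, s != t -> lt s t = ~~ lt t s) ->
  linear D -> D \o twist L = twist L \o D -> homogeneous_map (homog L) d D ->
  linear D' -> D' \o twist L = twist L \o D' -> homogeneous_map (homog L) e D' ->
  slot_derivation k d D -> slot_derivation l e D' ->
  slot_derivation (k + l) (d + e) (fun v => D (D' v) - eps d e *: D' (D v)).
Proof.
move=> lT ltxx lt_total lD cD hD lD' cD' hD' dD dD' dz z hz.
rewrite (slot_derivation_comp lD cD hD' dD dD' hz).
rewrite (slot_derivation_comp lD' cD' hD dD' dD hz).
(* Both double sums are split into the diagonal, where the two maps hit the same slot, and the
   rest. *)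
under eq_bigr => s _ do rewrite (bigD1 s) //= eqxx (negbTE (ltxx s)) mulr1.
under [X in _ - _ *: X]eq_bigr => s _ do
  rewrite (bigD1 s) //= eqxx (negbTE (ltxx s)) mulr1.
rewrite !big_split /= scalerDr opprD addrACA.
rewrite [X in _ + X = _](_ : _ = 0) ?addr0; last first.
  apply/eqP; rewrite subr_eq0; apply/eqP.
  (* After the exchange, [t] is the slot hit by [D] and [s] the one hit by [D'] on both sides, so
     terms match one by one. *)
  rewrite (exchange_big_dep xpredT) //= scaler_sumr.
  apply: eq_bigr => t _; rewrite scaler_sumr; apply: eq_big => [s|s ts].
    by rewrite eq_sym.
  have st : s != t by rewrite eq_sym.
  rewrite (negbTE ts) (negbTE st) scalerA; congr (_ *: T _).
    (* If [t] precedes [s], the outer [eps d e] cancels against [eps e d]; otherwise [eps d e]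
       appears on both sides. *)
    rewrite (lt_total _ _ st); case: (lt t s) => /=.
      by rewrite mulr1 mulrC [in RHS]mulrCA bichar_skew mulr1 mulrC.
    by rewrite !mulr1 mulrC [X in _ * X]mulrC.
  apply/funext => r; rewrite /two_slots [in RHS]addnC.
  by case: (eqVneq r s) => // ->; rewrite (negbTE st).
(* On the diagonal the two coefficients merge into the one for degree [d + e], and linearity of [T]
   in slot [s] joins both terms into the commutator. *)
rewrite scaler_sumr -sumrB; apply: eq_bigr => s _.
rewrite [(l + k)%N]addnC [eps e _ * eps d _]mulrC -bicharDl scalerA.
rewrite [D (D' (z s)) - _]addrC -[- (_ *: D' _)]scaleNr.
rewrite (lT s (iter (k + l) (twist L) \o z)) scalerDr addrC scalerA.
by rewrite mulrN [in RHS]mulrC scaleNr.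
Qed.

End SlotDerivations.

(** * The nested bracket as an operation whose slots are the x's followed by the y's *)

Section DoubleDerivations.
Context {K : fieldType} {G : zmodType} {eps : skewBicharacter K G} {m : nat}.
Context (L : homLieColor eps m.+1).

(* The slots of [x_1, ..., x_(n-1), [y_1, ..., y_n]], inl for the x's. *)
Definition slot_lt : rel ('I_m + 'I_m.+1) := fun s t =>
  match s, t with
  | inl i, inl j => (i < j)%N
  | inr i, inr j => (i < j)%N
  | inl _, inr _ => true
  | inr _, inl _ => false
  end.

Lemma slot_lt_irr s : ~~ slot_lt s s.
Proof. by case: s => i /=; rewrite ltnn. Qed.

Lemma slot_lt_total s t : s != t -> slot_lt s t = ~~ slot_lt t s.
Proof. by case: s t => i [] j //= ij; rewrite -leqNgt ltn_neqAle ij. Qed.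

Definition double_br (z : 'I_m + 'I_m.+1 -> L) : L :=
  br (with_last (n := m.+1) (z \o inl) (br (z \o inr))).

Lemma eta_with_inl (T : Type) (z : 'I_m + 'I_m.+1 -> T) i u :
  [eta z with inl i |-> u] \o inl = [eta z \o inl with i |-> u].
Proof. by apply/funext. Qed.

Lemma eta_with_inr (T : Type) (z : 'I_m + 'I_m.+1 -> T) i u :
  [eta z with inr i |-> u] \o inr = [eta z \o inr with i |-> u].
Proof. by apply/funext. Qed.

Lemma with_last_comp (T : Type) (f : T -> T) (x : 'I_m -> T) u :
  f \o with_last (n := m.+1) x u = with_last (n := m.+1) (f \o x) (f u).
Proof. by apply/funext => i; rewrite /with_last /=; case: insub. Qed.

(** Puts a change of one of the first arguments in the single-slot form required by [br_linear]. *)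
Lemma with_last_widen (T : Type) (x : 'I_m -> T) i u v :
  with_last (n := m.+1) [eta x with i |-> u] v =
  [eta with_last (n := m.+1) x v with widen_ord (leqnSn m) i |-> u].
Proof.
apply/funext => j; rewrite /with_last /=.
case: insubP => [j' _ jj'|mj] /=; first by rewrite -!val_eqE /= jj'.
by case: eqP => [ji|//]; rewrite ji /= ltn_ord in mj.
Qed.

Lemma with_last_max (T : Type) (x : 'I_m -> T) u v :
  with_last (n := m.+1) x u = [eta with_last (n := m.+1) x v with ord_max |-> u].
Proof.
apply/funext => j; rewrite /with_last /=.
case: insubP => [j' jm jj'|mj] /=.
  by rewrite -val_eqE /= ltn_eqF.
by rewrite -val_eqE /= eqn_leq -ltnS ltn_ord leqNgt mj.
Qed.

Lemma br_last_linear (x : 'I_m -> L) :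
  linear (fun u => br (A := L) (with_last (n := m.+1) x u)).
Proof.
(* The value 0 is a placeholder, overwritten by the update at [ord_max]. *)
move=> a u v; rewrite (with_last_max x (a *: u + v) 0) (with_last_max x u 0).
by rewrite (with_last_max x v 0); exact: br_linear.
Qed.

(** An [inl] slot belongs to the outer bracket; an [inr] slot is linear in the inner bracket, which
    sits in the last slot of the outer one. *)
Lemma double_br_linear s z : linear (fun u => double_br [eta z with s |-> u]).
Proof.
move=> a u v; rewrite /double_br; case: s => i.
  by rewrite !eta_with_inl !with_last_widen (br_linear (widen_ord _ i)).
by rewrite !eta_with_inr (br_linear i) br_last_linear.
Qed.

Lemma twist_double_br : multiplicative_hlc L ->
  forall z, twist L (double_br z) = double_br (twist L \o z).
Proof.
by move=> mL z; rewrite /double_br mL with_last_comp mL.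
Qed.

(** A sum over the disjoint union of slots splits into the x-sum and the y-sum. No y precedes an x,
    and every x precedes each y, which gives the degrees [X_i] and [X + Y_j]. *)
Lemma double_derivationP k d D : double_derivation L k d D <->
  gl_homog L d D /\ slot_derivation slot_lt double_br k d D.
Proof.
have expand (dz : 'I_m + 'I_m.+1 -> G) (z : 'I_m + 'I_m.+1 -> L) :
  \sum_s eps d (prefix_degree slot_lt dz s) *:
      double_br [eta iter k (twist L) \o z with s |-> D (z s)] =
  \sum_(i < m) eps d (\sum_(l < m | (l < i)%N) dz (inl l)) *:
      br (with_last (n := m.+1)
        [eta iter k (twist L) \o (z \o inl) with i |-> D (z (inl i))]
        (br (iter k (twist L) \o (z \o inr))))
  + \sum_(j < m.+1)
      eps d (\sum_l dz (inl l) + \sum_(l < m.+1 | (l < j)%N) dz (inr l)) *: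
      br (with_last (n := m.+1) (iter k (twist L) \o (z \o inl))
        (br [eta iter k (twist L) \o (z \o inr) with j |-> D (z (inr j))])).
  rewrite big_sumType; congr (_ + _); apply: eq_bigr => i _; congr (eps d _ *: _).
  - by rewrite /prefix_degree big_sumType /= [X in _ + X]big_pred0 // addr0.
  - by rewrite /prefix_degree big_sumType.
split=> [[lD hD cD dD]|[[lD hD cD] dD]].
  split=> // dz z hz; rewrite expand.
  apply: (dD (dz \o inl) (dz \o inr) (z \o inl) (z \o inr)) => i /=; exact: hz.
split=> // dx dy x y hx hy.
pose dz s := match s with inl i => dx i | inr j => dy j end.
pose z s := match s with inl i => x i | inr j => y j end.
rewrite -[LHS]/(D (double_br z)) (dD dz) ?expand //.
by case.
Qed.

Lemma double_derivation_twist k d D : multiplicative_hlc L ->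
  double_derivation L k d D -> double_derivation L k.+1 d (D \o twist L).
Proof.
move=> mL /double_derivationP[hD dD]; apply/double_derivationP; split.
  by rewrite -[d]addr0; apply: gl_homog_comp => //; exact: gl_twist_homog.
exact: slot_derivation_twist (twist_double_br mL) dD.
Qed.

Lemma double_derivation_comm k l d e (D D' : gl_type L) :
  double_derivation L k d D -> double_derivation L l e D' ->
  double_derivation L (k + l) (d + e) (gl_comm D D').
Proof.
move=> /double_derivationP[hD dD] /double_derivationP[hD' dD'].
apply/double_derivationP; split; first exact: gl_deg_comm.
(* On homogeneous maps the bilinearly extended bracket is the explicit color commutator. *)
rewrite (gl_commE hD hD').
case: hD hD' => [lD gD cD] [lD' gD' cD'].
exact: (slot_derivation_comm double_br_linear slot_lt_irr slot_lt_total
          lD cD gD lD' cD' gD' dD dD').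
Qed.

End DoubleDerivations.

(** * Reduction from the span to homogeneous double derivations *)

Section SpanOfDoubleDerivations.
Context {K : fieldType} {G : zmodType} {eps : skewBicharacter K G} {n : nat}.
Context (L : homLieColor eps n).

Lemma double_der_of k d D : double_derivation L k d D -> double_der L D.
Proof.
by move=> dD; apply: Defs.sub_span; exists k => //; apply: Defs.sub_span; exists d.
Qed.

Lemma double_der_subspace : subspace (gl_fun (L := L) @^-1` double_der L).
Proof.
apply/subspaceP; split=> [|a u v]; first exact: (subspace0 (span_subspace _)).
exact: (subspaceL a (span_subspace _)).
Qed.

Lemma double_der_sub_gl : double_der L `<=` gl_space L.
Proof.
have sG : subspace (gl_space L) := gl_space_subspace L.
apply: (span_min sG) => D [k _].
apply: (span_min sG) => {}D [d _ [lD hD cD _]].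
by apply: Defs.sub_span; exists d.
Qed.

(** The span is formed among plain functions while [Q] lives in [gl_type], so the induction runs on
    the image [P] of [Q]; generators lift because they lie in [gl_space]. *)
Lemma double_der_ind (Q : set (gl_type L)) : subspace Q ->
  (forall k d (D : gl_type L), double_derivation L k d D -> Q D) ->
  forall D : gl_type L, double_der L D -> Q D.
Proof.
move=> sQ hQ D; pose P := [set h : L -> L | exists2 D : gl_type L, Q D & h = D].
have sP : subspace P.
  apply/subspaceP; split; first by exists 0 => //; exact: subspace0.
  move=> a _ _ [D1 Q1 ->] [D2 Q2 ->]; exists (a *: D1 + D2) => //.
  exact: subspaceL.
move=> hD; have [] : P D; last by move=> D' QD' /val_inj ->.
apply: (span_min sP) hD => h [k _]; apply: (span_min sP) => {}h [d _ dh].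
have hg : h \in gl_space L.
  by apply: mem_set; apply: double_der_sub_gl; exact: double_der_of dh.
by exists (GlType hg) => //; apply: (hQ k d).
Qed.

End SpanOfDoubleDerivations.

Theorem theorem8 (K : fieldType) (G : zmodType) (eps : skewBicharacter K G)
    (n : nat) (n_ge3 : (3 <= n)%N) (L : homLieColor eps n)
    (L_mult : multiplicative_hlc L) :
  double_der L `<=` gl_space L /\
  color_subalgebra (A := gl L) (gl_fun @^-1` double_der L).
Proof.
(* With [n] written as a successor, [n.-1] computes to [m], matching the slot index type. *)
case: n n_ge3 L L_mult => // m _ L L_mult.
split; first exact: double_der_sub_gl.
pose U : set (gl_type L) := gl_fun (L := L) @^-1` double_der L.
have sU : subspace U := double_der_subspace L.
split.
- split; first exact: sU.
  (* Gradedness: the spanning double derivations are themselves homogeneous in [gl]. *)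
  apply: double_der_ind => [|k d D dD]; first exact: span_subspace.
  apply: Defs.sub_span; exists d => //; split; first exact: double_der_of dD.
  by have /double_derivationP[] := dD.
- apply: (double_der_ind (Q := @gl_twist _ _ _ _ L @^-1` U)).
    exact: (subspace_preimage (@gl_twist_linear _ _ _ _ L) sU).
  move=> k d D dD; exact: double_der_of (double_derivation_twist L_mult dD).
- move=> x Ux; rewrite -[br x]/(gl_comm (x ord0) (x ord_max)).
  move: (x ord0) (x ord_max) (Ux ord0) (Ux ord_max) => f g Uf Ug.
  (* By bilinearity of the bracket, first [f] and then [g] is replaced by a homogeneous double
     derivation. *)
  apply: (double_der_ind (Q := (@gl_comm _ _ _ _ L ^~ g) @^-1` U)) Uf.
    exact: (subspace_preimage (gl_comm_linearl g) sU).
  move=> k d D dD.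
  apply: (double_der_ind (Q := gl_comm D @^-1` U)) Ug.
    exact: (subspace_preimage (gl_comm_linearr D) sU).
  move=> l e D' dD'; exact: double_der_of (double_derivation_comm dD dD').
Qed.
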